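(* Let $n\ge 1$, let $\alpha, G, D>0$, let $\mathcal{B}\subset\mathbb{R}^n$ be a nonempty closed convex set with Euclidean diameter $D$, and let $r:\mathbb{R}^n\to\mathbb{R}$ be a convex (not necessarily smooth) function. Set $\eta=\frac12\min\{\alpha,\frac{1}{4GD}\}$ and $\epsilon=\frac{1}{\eta^2D^2}$. Then there is a constant $C$, depending only on $n,\alpha,G,\mathcal{B}$ and $r$, such that the following holds for every integer $T\ge 2$. Let $f_1,\dots,f_T$ be convex differentiable functions that are $\alpha$-exp-concave over $\mathcal{B}$ and satisfy $\|\nabla f_t(\mathbf{w})\|_2\le G$ for all $\mathbf{w}\in\mathcal{B}$ and all $t$, and let $\mathbf{w}_1,\dots,\mathbf{w}_T$ be the predictions of the composite online Newton step procedure (defined in the context) run on $f_1,\dots,f_T$ with parameters $\epsilon,\eta$, regularizer $r$ and initial point $\mathbf{w}_1\in\mathcal{B}$. Then for every fixed point $\mathbf{w}_*\in\mathcal{B}$, $$\sum_{t=1}^{T}\bigl(f_t(\mathbf{w}_t)+r(\mathbf{w}_t)-f_t(\mathbf{w}_* )-r(\mathbf{w}_* )\bigr)\le C\log T ,$$ that is, the regret with respect to the composite loss $f_t+r$ is $O(\log T)$.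
   Context: Exp-concavity: for $\alpha>0$, a convex function $f$ is $\alpha$-exp-concave over a convex set $\mathcal{B}\subset\mathbb{R}^n$ if $\mathbf{x}\mapsto\exp(-\alpha f(\mathbf{x}))$ is concave on $\mathcal{B}$. Bregman divergence: for a positive-definite matrix $A\in\mathbb{R}^{n\times n}$ and $\mathbf{w},\mathbf{x}\in\mathbb{R}^n$, $\mathcal{D}_A(\mathbf{w}\|\mathbf{x})=\frac12(\mathbf{w}-\mathbf{x})^{T}A(\mathbf{w}-\mathbf{x})$. Composite online Newton step procedure with parameters $\epsilon,\eta>0$, convex regularizer $r$ and initial point $\mathbf{w}_1\in\mathcal{B}$: set $A_0=\epsilon I_n$ ($I_n$ is the identity matrix). In each round $t=1,2,\dots$, the player plays $\mathbf{w}_t\in\mathcal{B}$, the loss function $f_t$ is revealed, and the player updates (gradients are column vectors) $$A_t=A_{t-1}+\nabla f_t(\mathbf{w}_t)\nabla f_t(\mathbf{w}_t)^{T},$$ $$\mathbf{w}_{t+1}=\arg\min_{\mathbf{w}\in\mathcal{B}}\bigl\{\langle\nabla f_t(\mathbf{w}_t),\mathbf{w}-\mathbf{w}_t\rangle+r(\mathbf{w})+\eta\,\mathcal{D}_{A_t}(\mathbf{w}\|\mathbf{w}_t)\bigr\}.$$ *)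

(* Defs.v *)
From HB Require Import structures.
From mathcomp Require Import all_boot all_order all_algebra.
From mathcomp Require Import all_classical all_reals all_analysis.
Set Implicit Arguments.
Unset Strict Implicit.
Unset Printing Implicit Defensive.
Import Order.TTheory GRing.Theory Num.Theory.
Import numFieldNormedType.Exports.
Local Open Scope classical_set_scope.
Local Open Scope ring_scope.

(* The library norm on 'cV[R]_n is the sup norm: it induces the usual topology
   and differentiability, but Euclidean lengths need [l2norm]. *)
Definition dotv (R : realType) (n : nat) (u v : 'cV[R]_n) : R :=
  (u^T *m v) ord0 ord0.

Definition l2norm (R : realType) (n : nat) (u : 'cV[R]_n) : R :=
  Num.sqrt (dotv u u).

(* Extended-real valued; +oo exactly when B is unbounded. *)
Definition l2diameter (R : realType) (n : nat) (B : set 'cV[R]_n) : \bar R :=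
  ereal_sup [set z | exists x y, [/\ B x, B y & z = (l2norm (x - y))%:E]].

Definition grad (R : realType) (n : nat) (f : 'cV[R]_n -> R) (x : 'cV[R]_n) :
    'cV[R]_n :=
  \col_(i < n) 'D_(delta_mx i ord0) f x.

Definition concave_function (R : realType) (n : nat) (B : set 'cV[R]_n)
    (f : 'cV[R]_n -> R) : Prop :=
  convex_function B (fun x => - f x).

Definition exp_concave (R : realType) (n : nat) (alpha : R)
    (B : set 'cV[R]_n) (f : 'cV[R]_n -> R) : Prop :=
  concave_function B (fun x => expR (- (alpha * f x))).

Definition bregman (R : realType) (n : nat) (A : 'M[R]_n) (w x : 'cV[R]_n) : R :=
  2^-1 * ((w - x)^T *m A *m (w - x)) ord0 ord0.

Definition argmin (R : realType) (T : Type) (B : set T) (F : T -> R) : set T :=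
  [set w | B w /\ forall v, B v -> F w <= F v].

(* Rounds are numbered from 1: f 0 and w 0 are never used. *)
Fixpoint ons_matrix (R : realType) (n : nat) (eps : R)
    (f : nat -> 'cV[R]_n -> R) (w : nat -> 'cV[R]_n) (t : nat) : 'M[R]_n :=
  match t with
  | 0 => eps%:M
  | s.+1 => ons_matrix eps f w s
            + grad (f s.+1) (w s.+1) *m (grad (f s.+1) (w s.+1))^T
  end.

Definition ons_objective (R : realType) (n : nat) (eps eta : R)
    (r : 'cV[R]_n -> R) (f : nat -> 'cV[R]_n -> R) (w : nat -> 'cV[R]_n)
    (t : nat) (v : 'cV[R]_n) : R :=
  dotv (grad (f t) (w t)) (v - w t) + r v
  + eta * bregman (ons_matrix eps f w t) v (w t).

(* w 1, ..., w T are the predictions of the first T rounds; the update closing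
   round T produces w T.+1 and is not constrained. *)
Definition composite_ons (R : realType) (n : nat) (eps eta : R)
    (B : set 'cV[R]_n) (r : 'cV[R]_n -> R) (T : nat)
    (f : nat -> 'cV[R]_n -> R) (w : nat -> 'cV[R]_n) : Prop :=
  B (w 1%N) /\
  forall t : nat, (1 <= t < T)%N ->
    argmin B (ons_objective eps eta r f w t) (w t.+1).

(* Main.v *)
(* Exp-concavity and boundedness of |<grad f_t(w_t), u - w_t>| by G D upgrade the
   first-order convexity bound to
     f_t(u) >= f_t(w_t) + z + (eta/2) z^2,   z = <grad f_t(w_t), u - w_t>.
   The quadratic term cancels exactly the growth of the Bregman divergence when
   A_{t-1} is replaced by A_t, so with the three-point inequality for w_{t+1}
   each round t < T costs at most the drop of the potential
     eta D_{A_t}(u || w_{t+1}) + r(w_{t+1}) - ln(det A_t) / (2 eta):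
   Fenchel's inequality leaves g^T A_t^{-1} g / (2 eta), which is at most the
   increase of ln(det A_t) / (2 eta) by the matrix determinant lemma.  The last
   round, whose update is unconstrained, costs at most G D plus a difference of
   values of r, and r is bounded on B.  Leibniz' formula bounds det A_T by
   n! (eps + T G^2)^n, whose logarithm is O(log T). *)
Require Import Defs.
From HB Require Import structures.
From mathcomp Require Import all_boot all_order all_algebra.
From mathcomp Require Import all_classical all_reals all_analysis.
From mathcomp Require Import ring lra.
From mathcomp Require unstable perm.
Set Implicit Arguments.
Unset Strict Implicit.
Unset Printing Implicit Defensive.
Import Order.TTheory GRing.Theory Num.Theory.
Import numFieldNormedType.Exports.
Local Open Scope classical_set_scope.
Local Open Scope ring_scope.

(** * Euclidean inner product and norm *)

Lemma dotvE (R : realType) (n : nat) (u v : 'cV[R]_n) :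
  dotv u v = \sum_i u i ord0 * v i ord0.
Proof. by rewrite /dotv mxE; apply: eq_bigr => i _; rewrite mxE. Qed.

Lemma dotvC (R : realType) (n : nat) (u v : 'cV[R]_n) : dotv u v = dotv v u.
Proof. by rewrite !dotvE; apply: eq_bigr => i _; rewrite mulrC. Qed.

Lemma dotvDl (R : realType) (n : nat) (u v z : 'cV[R]_n) :
  dotv (u + v) z = dotv u z + dotv v z.
Proof. by rewrite /dotv linearD mulmxDl mxE. Qed.

Lemma dotvDr (R : realType) (n : nat) (u v z : 'cV[R]_n) :
  dotv z (u + v) = dotv z u + dotv z v.
Proof. by rewrite /dotv mulmxDr mxE. Qed.

Lemma dotvZl (R : realType) (n : nat) (a : R) (u v : 'cV[R]_n) :
  dotv (a *: u) v = a * dotv u v.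
Proof. by rewrite /dotv linearZ -scalemxAl mxE. Qed.

Lemma dotvZr (R : realType) (n : nat) (a : R) (u v : 'cV[R]_n) :
  dotv u (a *: v) = a * dotv u v.
Proof. by rewrite dotvC dotvZl dotvC. Qed.

Lemma dotvNr (R : realType) (n : nat) (u v : 'cV[R]_n) :
  dotv u (- v) = - dotv u v.
Proof. by rewrite -scaleN1r dotvZr mulN1r. Qed.

Lemma dotvNl (R : realType) (n : nat) (u v : 'cV[R]_n) :
  dotv (- u) v = - dotv u v.
Proof. by rewrite dotvC dotvNr dotvC. Qed.

Lemma dotvBr (R : realType) (n : nat) (u v z : 'cV[R]_n) :
  dotv z (u - v) = dotv z u - dotv z v.
Proof. by rewrite dotvDr dotvNr. Qed.

Lemma dotv_ge0 (R : realType) (n : nat) (u : 'cV[R]_n) : 0 <= dotv u u.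
Proof. by rewrite dotvE sumr_ge0// => i _; rewrite -expr2 sqr_ge0. Qed.

Lemma dotv_eq0 (R : realType) (n : nat) (u : 'cV[R]_n) : dotv u u = 0 -> u = 0.
Proof.
rewrite dotvE => /psumr_eq0P u0; apply/matrixP => i j; rewrite ord1 mxE.
have /eqP := u0 (fun k _ => sqr_ge0 (u k ord0)) i isT.
by rewrite -expr2 sqrf_eq0 => /eqP.
Qed.

Lemma dotv_mulmx (R : realType) (n : nat) (A : 'M[R]_n) (u v : 'cV[R]_n) :
  dotv u (A *m v) = dotv (A^T *m u) v.
Proof. by rewrite /dotv trmx_mul trmxK mulmxA. Qed.

Lemma dotv_rank1 (R : realType) (n : nat) (g u v : 'cV[R]_n) :
  dotv u (g *m g^T *m v) = dotv g u * dotv g v.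
Proof.
rewrite (dotvC g u) /dotv -mulmxA mulmxA.
by rewrite {1}[g^T *m v]mx11_scalar mul_mx_scalar mxE mulrC.
Qed.

Lemma cauchy_schwarz_dotv (R : realType) (n : nat) (u v : 'cV[R]_n) :
  `|dotv u v| <= l2norm u * l2norm v.
Proof.
rewrite /l2norm -sqrtrM ?dotv_ge0// -sqrtr_sqr; apply: ler_wsqrtr.
have [v0|v0] := eqVneq (dotv v v) 0.
  by rewrite (dotv_eq0 v0) /dotv !mulmx0 !mxE expr0n mulr0.
have vp : 0 < dotv v v by rewrite lt_neqAle eq_sym v0 dotv_ge0.
(* With the abbreviations set just below, the squared length of [c *: u - b *: v] expands to
   [c * (a * c - b ^+ 2)], and [c] is positive. *)
have := dotv_ge0 (dotv v v *: u + (- dotv u v) *: v).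
rewrite !(dotvDl, dotvDr, dotvZl, dotvZr) (dotvC v u).
set a := dotv u u; set b := dotv u v; set c := dotv v v => h.
have : 0 <= c * (a * c - b ^+ 2) by lra.
by rewrite pmulr_rge0 // subr_ge0.
Qed.

Lemma abs_coord_le_l2norm (R : realType) (n : nat) (u : 'cV[R]_n) i :
  `|u i ord0| <= l2norm u.
Proof.
rewrite /l2norm -sqrtr_sqr; apply: ler_wsqrtr.
rewrite dotvE (bigD1 i)//= -expr2 lerDl sumr_ge0// => j _.
by rewrite -expr2 sqr_ge0.
Qed.

Lemma l2norm_diameter (R : realType) (n : nat) (B : set 'cV[R]_n) (D : R) :
  l2diameter B = D%:E -> forall x y, B x -> B y -> l2norm (x - y) <= D.
Proof.
move=> BD x y Bx By; rewrite -lee_fin -BD; apply: ereal_sup_ubound.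
by exists x, y.
Qed.

(** * Convexity along segments and the gradient inequality *)

Lemma conv_segment (R : numFieldType) (E : lmodType R) (s : R)
    (s0 : 0 <= s) (s1 : s <= 1) (x y : convex_lmodType E) :
  conv (Itv01 s0 s1) y x = (x : E) + s *: ((y : E) - (x : E)).
Proof.
rewrite /conv/= /unstable.onem scalerBl scale1r scalerBr addrC -addrA.
by congr (_ + _); rewrite addrC.
Qed.

Lemma convex_setP (R : realType) (n : nat) (B : set 'cV[R]_n) :
  convex_set B -> forall x y s, B x -> B y -> 0 <= s -> s <= 1 ->
  B (x + s *: (y - x)).
Proof.
move=> cB x y s Bx By s0 s1; rewrite -(conv_segment s0 s1).
by apply/set_mem/cB; apply/mem_set.
Qed.

Lemma convex_functionP (R : realType) (n : nat) (B : set 'cV[R]_n)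
    (f : 'cV[R]_n -> R) :
  convex_function B f -> forall x y s, B x -> B y -> 0 <= s -> s <= 1 ->
  f (x + s *: (y - x)) <= f x + s * (f y - f x).
Proof.
move=> cf x y s Bx By s0 s1; rewrite -(conv_segment s0 s1).
apply: le_trans (cf (Itv01 s0 s1) y x _ _) _; try exact/mem_set.
by rewrite convRE/= /unstable.onem; lra.
Qed.

Lemma derive_grad (R : realType) (n : nat) (f : 'cV[R]_n -> R)
    (x v : 'cV[R]_n) : differentiable f x -> 'D_v f x = dotv (grad f x) v.
Proof.
move=> df; rewrite deriveE// {1}(matrix_sum_delta v) linear_sum dotvE.
apply: eq_bigr => i _; rewrite big_ord1 linearZ/= mxE deriveE//.
by rewrite mulrC.
Qed.

(** Difference quotients with step in [(0, 1]] are at most [f y - f x] by convexity on the segment,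
    and the bound survives the limit from the right. The directional form suits composites treated
    by the chain rule. *)
Lemma convex_derive_le (R : realType) (n : nat) (B : set 'cV[R]_n)
    (f : 'cV[R]_n -> R) (x y : 'cV[R]_n) :
  convex_function B f -> B x -> B y -> differentiable f x ->
  'D_(y - x) f x <= f y - f x.
Proof.
move=> cf Bx By df.
have dq : derivable f x (y - x) by exact: diff_derivable.
rewrite /derive cvg_at_rightE//; apply: limr_le.
  by apply: cvgP; apply: cvg_dnbhs_at_right; exact: dq.
near=> h.
have h0 : 0 < h by near: h; exact: nbhs_right_gt.
have h1 : h <= 1 by near: h; exact: nbhs_right_le.
rewrite /= -[leLHS]/(h^-1 * _) mulrC ler_pdivrMr// [leRHS]mulrC lerBlDl.
rewrite [h *: _ + x]addrC.
exact: convex_functionP cf _ _ _ Bx By (ltW h0) h1.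
Unshelve. all: by end_near. Qed.

Lemma convex_grad_le (R : realType) (n : nat) (B : set 'cV[R]_n)
    (f : 'cV[R]_n -> R) (x y : 'cV[R]_n) :
  convex_function B f -> B x -> B y -> differentiable f x ->
  dotv (grad f x) (y - x) <= f y - f x.
Proof. by move=> *; rewrite -derive_grad//; exact: convex_derive_le. Qed.

(** * The quadratic lower bound from exp-concavity *)

Lemma expR_ge_quartic (R : realType) (x : R) :
  -4 <= x -> (1 + x / 4) ^+ 4 <= expR x.
Proof.
move=> x4; rewrite {2}(_ : x = 4%:R * (x / 4)); last by field.
by rewrite expRM_natl lerXn2r ?nnegrE ?expR_ge0 ?expR_ge1Dx//; lra.
Qed.

(** The tangent bound [1 + x <= expR x] loses the term [u ^+ 2 / 4]; its fourth-power version at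
    [x / 4] is sharp enough and leaves a polynomial inequality. *)
Lemma onem_le_expR (R : realType) (u : R) :
  `|u| <= 1 / 4 -> 1 - u <= expR (- u - u ^+ 2 / 4).
Proof.
rewrite ler_norml => /andP[u0 u1].
have u2 : u ^+ 2 <= 1 / 16 by nra.
apply: le_trans (expR_ge_quartic _); last by lra.
(* The exponent is [- u * k], so the quartic is [(1 - u * k / 4) ^+ 4]; its excess over [1 - u] is
   [u ^+ 2] times the factor in [main], plus a fourth power. *)
set k := 1 + u / 4.
have k0 : 15 / 16 <= k by rewrite /k; lra.
have k1 : k <= 17 / 16 by rewrite /k; lra.
have k2 : k ^+ 2 <= 289 / 256 by nra.
have k3 : k ^+ 3 <= 13 / 10 by rewrite exprS; nra.
have k3' : 0 <= k ^+ 3 by rewrite exprn_ge0//; lra.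
have main : 0 <= 3 / 8 * k ^+ 2 - 1 / 4 - u * k ^+ 3 / 16 by nra.
rewrite -subr_ge0 [leRHS](_ : _ = u ^+ 2 * (3 / 8 * k ^+ 2 - 1 / 4 - u * k ^+ 3 / 16)
  + (u * k) ^+ 4 / 256); last by rewrite /k; field.
apply: addr_ge0; first by rewrite mulr_ge0 ?sqr_ge0.
by rewrite divr_ge0// exprn_even_ge0.
Qed.

(** With [d = f y - f x], the gradient inequality for [- expR (- alpha * f)], divided by
    [expR (- alpha * f x)], gives [expR (- alpha * d) <= 1 - alpha * z]. The same holds for the
    smaller [gamma], and [onem_le_expR] at [u = gamma * z] lets one compare exponents. *)
Lemma exp_concave_quadratic (R : realType) (n : nat) (alpha gamma : R)
    (B : set 'cV[R]_n) (f : 'cV[R]_n -> R) (x y : 'cV[R]_n) :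
  0 < gamma -> gamma <= alpha -> exp_concave alpha B f ->
  B x -> B y -> differentiable f x ->
  gamma * `|dotv (grad f x) (y - x)| <= 1 / 4 ->
  dotv (grad f x) (y - x) + gamma / 4 * dotv (grad f x) (y - x) ^+ 2
    <= f y - f x.
Proof.
move=> g0 ga cf Bx By df; rewrite -derive_grad//; set z := 'D_ _ _ _ => zle.
have a0 : 0 < alpha by lra.
pose h : R -> R := fun s => - expR (- (alpha * s)).
have dh (s : R) : is_derive s (1 : R) h (alpha * expR (- (alpha * s))).
  by rewrite /h; apply: is_derive_eq; rewrite /GRing.scale/=; ring.
have dh' : differentiable h (f x) by apply/derivable1_diffP; case: (dh (f x)).
have Dh : 'D_(y - x) (h \o f) x = z * (alpha * expR (- (alpha * f x))).
  rewrite deriveE; last exact: differentiable_comp.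
  by rewrite diff_comp//= diff1E// derive1E derive_val -deriveE.
have := convex_derive_le cf Bx By (differentiable_comp df dh').
rewrite [X in X <= _]Dh => {Dh}.
set d := f y - f x => hd.
have e1 : expR (- (alpha * d)) <= 1 - alpha * z.
  rewrite (_ : - (alpha * d) = - (alpha * f y) + alpha * f x); last by rewrite /d; ring.
  rewrite expRD -[X in _ * expR X]opprK [expR (- - _)]expRN ler_pdivrMr ?expR_gt0//.
  lra.
have p0 : 0 <= gamma / alpha by rewrite divr_ge0// ltW.
have p1 : gamma / alpha <= 1 by rewrite ler_pdivrMr// mul1r.
(* Convexity of exp lowers the exponent from alpha to gamma. *)
have e2 : expR (- (gamma * d)) <= 1 - gamma * z.
  have := convex_expR (Itv01 p0 p1) (- (alpha * d)) 0.
  rewrite !convRE/= /unstable.onem mulr0 addr0 expR0 mulr1 mulrN mulrA mulfVK ?gt_eqF//.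
  move=> /le_trans; apply.
  apply: (@le_trans _ _ (gamma / alpha * (1 - alpha * z) + (1 - gamma / alpha))).
    by rewrite lerD2r ler_wpM2l.
  rewrite mulrBr mulr1 mulrA mulfVK ?gt_eqF//; lra.
have /onem_le_expR : `|gamma * z| <= 1 / 4.
  by rewrite normrM gtr0_norm.
move=> /(le_trans e2); rewrite ler_expR => le.
rewrite -(ler_pM2l g0); lra.
Qed.

(** * Boundedness of convex functions on boxes *)

(* Induction on the number of coordinates allowed to be nonzero: split off one
   coordinate and bound [r] at the midpoint of the doubled parts. *)
Lemma convex_upper_bound (R : realType) (n : nat) (r : 'cV[R]_n -> R) :
  convex_function setT r -> forall (k : nat) (M : R), 0 <= M ->
  exists K, forall x : 'cV[R]_n, (forall i, `|x i ord0| <= M) ->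
    (forall i : 'I_n, (k <= i)%N -> x i ord0 = 0) -> r x <= K.
Proof.
move=> cr; elim=> [|k IH] M M0.
  exists (r 0) => x _ x0; rewrite (_ : x = 0)//.
  by apply/matrixP => i j; rewrite ord1 mxE x0.
have [kn|nk] := ltnP k n; last first.
  have [K HK] := IH M M0; exists K => x xM _; apply: HK => // i ki.
  by have := leq_trans (leq_trans (ltn_ord i) nk) ki; rewrite ltnn.
pose e : 'cV[R]_n := delta_mx (Ordinal kn) ord0.
(* The point [(2 * c) *: e] lies between [- N *: e] and [N *: e]; the extra 1 keeps this segment
   nondegenerate when [M = 0]. *)
pose N := 2 * M + 1.
have N0 : 0 < N by rewrite /N; lra.
have [K HK] := IH (2 * M) (mulr_ge0 (ler0n _ 2) M0).
exists (2^-1 * (K + (`|r (N *: e)| + `|r (- N *: e)|))) => x xM x0.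
pose c := x (Ordinal kn) ord0.
have cM : `|c| <= M by exact: xM.
pose x' := x - c *: e.
have x'E i : x' i ord0 = if i == Ordinal kn then 0 else x i ord0.
  rewrite !mxE eqxx andbT; case: eqP => [->|_]; first by rewrite mulr1 subrr.
  by rewrite mulr0 subr0.
have -> : x = 2 *: x' + 2^-1 *: ((2 * c) *: e - 2 *: x').
  by apply/matrixP => i j; rewrite ord1 !mxE; field.
have h0 : 0 <= 2^-1 :> R by lra.
have h1 : 2^-1 <= 1 :> R by lra.
apply: le_trans (convex_functionP cr I I h0 h1) _.
have rx' : r (2 *: x') <= K.
  apply: HK => i; rewrite mxE x'E.
    by case: eqP => _; rewrite ?mulr0 ?normr0 ?normrM ?normr_nat ?ler_wpM2l// mulr_ge0.
  move=> ki; case: eqP => [_|ik]; rewrite ?mulr0// x0 ?mulr0// ltn_neqAle ki andbT.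
  by apply/eqP => kE; apply: ik; apply/val_inj.
have re : r ((2 * c) *: e) <= `|r (N *: e)| + `|r (- N *: e)|.
  move: cM; rewrite ler_norml => /andP[c0 c1].
  pose s := (2 * c + N) / (2 * N).
  have s0 : 0 <= s by rewrite divr_ge0 /N; lra.
  have s1 : s <= 1 by rewrite ler_pdivrMr /N; lra.
  have -> : (2 * c) *: e = - N *: e + s *: (N *: e - - N *: e).
    rewrite -scalerBl scalerA -scalerDl; congr (_ *: _); rewrite /s; field.
    by rewrite gt_eqF.
  apply: le_trans (convex_functionP cr I I s0 s1) _.
  have := ler_norm (r (N *: e)); have := ler_norm (r (- N *: e)).
  have := normr_ge0 (r (N *: e)); have := normr_ge0 (r (- N *: e)).
  set a := `|_|; set b := `|r (N *: e)|; nra.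
lra.
Qed.

(** The lower bound follows from the upper one by reflection: the box is symmetric and 0 is the
    midpoint of [x] and [- x], so [r x >= 2 * r 0 - r (- x)]. *)
Lemma convex_bounded (R : realType) (n : nat) (r : 'cV[R]_n -> R) (M : R) :
  convex_function setT r -> 0 <= M ->
  exists K, forall x : 'cV[R]_n, (forall i, `|x i ord0| <= M) -> `|r x| <= K.
Proof.
move=> cr M0; have [K HK] := convex_upper_bound cr n M0.
have ub (x : 'cV[R]_n) : (forall i, `|x i ord0| <= M) -> r x <= K.
  move=> xM; apply: HK => // i; rewrite leqNgt ltn_ord => //.
exists (`|K| + 2 * `|r 0|) => x xM; rewrite ler_norml.
have rx := ub x xM.
have rNx : r (- x) <= K by apply: ub => i; rewrite mxE normrN.
have := convex_functionP cr (x := x) (y := - x) (s := 2^-1) I I.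
have -> : x + 2^-1 *: (- x - x) = 0.
  by apply/matrixP => i j; rewrite ord1 !mxE; field.
have hh : 0 <= 2^-1 :> R by lra.
have hh1 : 2^-1 <= 1 :> R by lra.
move=> /(_ hh hh1) r0.
have := ler_norm K; have := ler_norm (- r 0); rewrite normrN.
have := ler_norm (r 0); move=> h1 h2 h3.
by apply/andP; split; lra.
Qed.

(** * Determinants: rank-one updates and an entrywise bound *)

(* Two factorisations of the block matrix [[A, -g], [h^T, 1]]. *)
Lemma det_add_rank1 (F : comUnitRingType) (n : nat) (A : 'M[F]_n)
    (g h : 'cV[F]_n) : A \in unitmx ->
  \det (A + g *m h^T) = \det A * (1 + (h^T *m (invmx A *m g)) ord0 ord0).
Proof.
move=> uA.
have E1 : block_mx A (- g) h^T 1%:M = block_mx 1%:M 0 (h^T *m invmx A) 1%:M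
    *m block_mx A (- g) 0 (1%:M + h^T *m (invmx A *m g)).
  rewrite mulmx_block !mul1mx !mul0mx !addr0 mulmxKV//.
  by rewrite mulmxN mulmxA addrCA addNr addr0.
have E2 : block_mx A (- g) h^T 1%:M = block_mx 1%:M (- g) 0 1%:M
    *m block_mx (A + g *m h^T) 0 h^T 1%:M.
  by rewrite mulmx_block !mul1mx !mul0mx !mulmx1 !add0r mulNmx addrK.
have := congr1 determinant E1; rewrite E2 !det_mulmx !det_ublock !det_lblock.
by rewrite !det1 !mul1r !mulr1 => ->; rewrite det_mx11 !mxE eqxx.
Qed.

Lemma det_le_bound (R : realDomainType) (n : nat) (A : 'M[R]_n) (M : R) :
  (forall i j, `|A i j| <= M) -> \det A <= n`!%:R * M ^+ n.
Proof.
move=> AM; rewrite /determinant -perm.card_Sn -sum1_card natr_sum mulr_suml.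
apply: ler_sum => s _; rewrite mul1r.
apply: le_trans (ler_norm _) _; rewrite normrM normrX normrN1 expr1n mul1r.
rewrite normr_prod -[in leRHS](card_ord n) -prodr_const.
by apply: ler_prod => i _; rewrite normr_ge0 AM.
Qed.

(** * Quadratic forms and the analysis of one update *)

Lemma bregmanE (R : realType) (n : nat) (A : 'M[R]_n) (w x : 'cV[R]_n) :
  bregman A w x = 2^-1 * dotv (w - x) (A *m (w - x)).
Proof. by rewrite /bregman /dotv mulmxA. Qed.

Lemma dotv_symmx (R : realType) (n : nat) (A : 'M[R]_n) (u v : 'cV[R]_n) :
  A^T = A -> dotv u (A *m v) = dotv v (A *m u).
Proof. by move=> sA; rewrite dotv_mulmx sA dotvC. Qed.

Lemma quad_addZ (R : realType) (n : nat) (A : 'M[R]_n) (u v : 'cV[R]_n) (s : R) :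
  A^T = A ->
  dotv (u + s *: v) (A *m (u + s *: v))
    = dotv u (A *m u) + 2 * s * dotv v (A *m u) + s ^+ 2 * dotv v (A *m v).
Proof.
move=> sA; rewrite mulmxDr -scalemxAr !(dotvDl, dotvDr, dotvZl, dotvZr).
by rewrite (dotv_symmx u v sA); ring.
Qed.

(** Extracts a first-order optimality condition from comparisons along a segment, with an explicit
    small [s] in place of a limit. *)
Lemma linear_coef_ge0 (R : realFieldType) (a b : R) :
  (forall s, 0 < s -> s <= 1 -> 0 <= s * a + s ^+ 2 * b) -> 0 <= a.
Proof.
move=> H; rewrite leNgt; apply/negP => a0.
have b1 : 0 < 2 * (`|b| + 1 - a) by have := normr_ge0 b; lra.
(* This choice makes [s * b] less than [- a / 2], hence [a + s * b] negative. *)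
pose s := - a / (2 * (`|b| + 1 - a)).
have s0 : 0 < s by rewrite divr_gt0// oppr_gt0.
have s1 : s <= 1 by rewrite ler_pdivrMr//; have := normr_ge0 b; lra.
have sE : s * (2 * (`|b| + 1 - a)) = - a by rewrite mulfVK ?gt_eqF.
have := H s s0 s1; rewrite (_ : _ + _ = s * (a + s * b)); last by ring.
rewrite pmulr_rge0//; have := ler_norm b => bb.
have : s * b <= s * `|b| by rewrite ler_wpM2l// ltW.
have : 0 <= s * (1 - a) by rewrite mulr_ge0//; lra.
lra.
Qed.

(** As [r] need not be differentiable, optimality is tested by moving from [w] towards [u] and
    bounding [r] by convexity. The nonnegative linear coefficient is the variational inequality at
    [w]; expanding [u - x = (w - x) + (u - w)] turns it into the three divergences. *)
Lemma argmin_three_point (R : realType) (n : nat) (A : 'M[R]_n) (eta : R)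
    (B : set 'cV[R]_n) (r : 'cV[R]_n -> R) (g x w u : 'cV[R]_n) :
  A^T = A -> convex_set B -> convex_function setT r ->
  argmin B (fun v => dotv g (v - x) + r v + eta * bregman A v x) w -> B u ->
  dotv g (w - u) + r w - r u
    <= eta * (bregman A u x - bregman A u w - bregman A w x).
Proof.
move=> sA cB cr [Bw wmin] Bu.
pose p := w - x; pose q := u - w.
have uxE : u - x = p + 1 *: q by rewrite scale1r /p /q [RHS]addrC addrA subrK.
suff : 0 <= dotv g q + r u - r w + eta * dotv q (A *m p).
  rewrite !bregmanE uxE quad_addZ// -/p -/q -[w - u]opprB dotvNr -/q; lra.
apply: (@linear_coef_ge0 _ _ (eta * 2^-1 * dotv q (A *m q))) => s s0 s1.
have := wmin _ (convex_setP cB Bw Bu (ltW s0) s1).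
have := convex_functionP cr (x := w) (y := u) I I (ltW s0) s1.
rewrite !bregmanE -/q -/p [w + _ - x](_ : _ = p + s *: q); last by rewrite addrAC.
rewrite quad_addZ// dotvDr dotvZr; lra.
Qed.

Lemma linear_sub_quad_le (R : realType) (n : nat) (A : 'M[R]_n) (eta : R)
    (g u : 'cV[R]_n) :
  A^T = A -> (forall v, 0 <= dotv v (A *m v)) -> A \in unitmx -> 0 < eta ->
  dotv g u - eta * (2^-1 * dotv u (A *m u))
    <= (2 * eta)^-1 * dotv g (invmx A *m g).
Proof.
move=> sA pA uA e0; set y := invmx A *m g.
have Ay : A *m y = g by rewrite mulKVmx.
(* y - eta u vanishes at the maximiser of the left-hand side. *)
have := pA (y + (- eta) *: u).
rewrite quad_addZ// Ay (dotvC y) (dotvC u) => h.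
rewrite -(ler_pM2l (mulr_gt0 (ltr0n _ 2) e0)) mulVKf; last first.
  by rewrite gt_eqF// mulr_gt0.
lra.
Qed.

(** The determinant lemma is used twice: forwards for positivity, and on [A = A' - g *m g^T] to get
    [\det A = \det A' * (1 - q)]. Then [ln (1 - q) <= - q] gives the bound. *)
Lemma det_rank1_update (R : realType) (n : nat) (A : 'M[R]_n) (g : 'cV[R]_n) :
  A^T = A -> (forall v, 0 <= dotv v (A *m v)) -> 0 < \det A ->
  0 < \det (A + g *m g^T) /\
  dotv g (invmx (A + g *m g^T) *m g) <= ln (\det (A + g *m g^T)) - ln (\det A).
Proof.
move=> sA pA dA; set A' := A + _.
have uA : A \in unitmx by rewrite unitmxE unitfE gt_eqF.
have q0 : 0 <= dotv g (invmx A *m g).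
  by have := pA (invmx A *m g); rewrite mulKVmx// dotvC.
have dA' : 0 < \det A' by rewrite det_add_rank1// mulr_gt0// ltr_pwDl.
have uA' : A' \in unitmx by rewrite unitmxE unitfE gt_eqF.
split=> //; set q := dotv g _.
have : \det A = \det A' * (1 - q).
  have {1}-> : A = A' + (- g) *m g^T by rewrite mulNmx addrK.
  by rewrite det_add_rank1// mulmxN mulmxN mxE.
move=> dE; have q1 : 0 < 1 - q by rewrite -(pmulr_rgt0 _ dA') -dE.
rewrite dE lnM ?posrE//.
have : ln (1 - q) <= - q by apply: le_ln1Dx; lra.
lra.
Qed.

(** * The matrices of the procedure *)

Lemma ons_matrix_sym (R : realType) (n : nat) (eps : R)
    (f : nat -> 'cV[R]_n -> R) (w : nat -> 'cV[R]_n) (t : nat) :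
  (ons_matrix eps f w t)^T = ons_matrix eps f w t.
Proof.
elim: t => [|t IH] /=; first exact: tr_scalar_mx.
by rewrite linearD/= IH trmx_mul trmxK.
Qed.

Lemma ons_matrix_psd (R : realType) (n : nat) (eps : R)
    (f : nat -> 'cV[R]_n -> R) (w : nat -> 'cV[R]_n) (t : nat) (v : 'cV[R]_n) :
  0 <= eps -> 0 <= dotv v (ons_matrix eps f w t *m v).
Proof.
move=> e0; elim: t => [|t IH] /=.
  by rewrite mul_scalar_mx dotvZr mulr_ge0// dotv_ge0.
by rewrite mulmxDl dotvDr dotv_rank1 addr_ge0// -expr2 sqr_ge0.
Qed.

Lemma ons_matrix_det_gt0 (R : realType) (n : nat) (eps : R)
    (f : nat -> 'cV[R]_n -> R) (w : nat -> 'cV[R]_n) (t : nat) :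
  0 < eps -> 0 < \det (ons_matrix eps f w t).
Proof.
move=> e0; elim: t => [|t IH] /=; first by rewrite det_scalar exprn_gt0.
have psd v := ons_matrix_psd f w t v (ltW e0).
by have [] := det_rank1_update (grad (f t.+1) (w t.+1)) (ons_matrix_sym _ _ _ _) psd IH.
Qed.

Lemma ons_matrix_entry_le (R : realType) (n : nat) (eps G : R)
    (f : nat -> 'cV[R]_n -> R) (w : nat -> 'cV[R]_n) (t : nat) :
  0 <= eps -> 0 <= G ->
  (forall s, (1 <= s <= t)%N -> l2norm (grad (f s) (w s)) <= G) ->
  forall i j, `|ons_matrix eps f w t i j| <= eps + t%:R * G ^+ 2.
Proof.
move=> e0 G0; elim: t => [|t IH] gG i j /=.
  by rewrite mxE mul0r addr0; case: eqP => _; rewrite ?mulr1n ?mulr0n ?normr0 ?ger0_norm.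
rewrite mxE; apply: le_trans (ler_normD _ _) _.
have H : `|ons_matrix eps f w t i j| <= eps + t%:R * G ^+ 2.
  by apply: IH => s /andP[s1 st]; apply: gG; rewrite s1 leqW.
have gle k : `|grad (f t.+1) (w t.+1) k ord0| <= G.
  by apply: le_trans (abs_coord_le_l2norm _ _) _; apply: gG; rewrite /= leqnn.
rewrite [X in _ + `|X|]mxE big_ord1 [X in _ + `|_ * X|]mxE normrM.
have : `|grad (f t.+1) (w t.+1) i ord0| * `|grad (f t.+1) (w t.+1) j ord0| <= G * G.
  by apply: ler_pM.
rewrite -natr1; lra.
Qed.

(** * Potential and telescoping *)

(** The point runs one index ahead of the matrix: the value at 0 involves only [eps%:M] and [w 1],
    and the value at [T - 1] involves [w T], the last constrained prediction. *)
Definition ons_potential (R : realType) (n : nat) (eps eta : R)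
    (r : 'cV[R]_n -> R) (f : nat -> 'cV[R]_n -> R) (w : nat -> 'cV[R]_n)
    (u : 'cV[R]_n) (t : nat) : R :=
  eta * bregman (ons_matrix eps f w t) u (w t.+1) + r (w t.+1)
  - (2 * eta)^-1 * ln (\det (ons_matrix eps f w t)).

Lemma ons_round (R : realType) (n : nat) (eps eta : R) (B : set 'cV[R]_n)
    (r : 'cV[R]_n -> R) (f : nat -> 'cV[R]_n -> R) (w : nat -> 'cV[R]_n)
    (u : 'cV[R]_n) (t : nat) (z : R) :
  0 < eps -> 0 < eta -> convex_set B -> convex_function setT r -> B u ->
  z = dotv (grad (f t.+1) (w t.+1)) (u - w t.+1) ->
  argmin B (ons_objective eps eta r f w t.+1) (w t.+2) ->
  r (w t.+1) - r u - z - eta / 2 * z ^+ 2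
    <= ons_potential eps eta r f w u t - ons_potential eps eta r f w u t.+1.
Proof.
move=> eps0 eta0 cB cr Bu zE wmin; rewrite /ons_potential.
have sA := ons_matrix_sym eps f w.
have psd k v := ons_matrix_psd f w k v (ltW eps0).
have dA k := ons_matrix_det_gt0 f w k eps0.
set g := grad (f t.+1) (w t.+1) in zE *.
have [_] := det_rank1_update g (sA t) (psd t) (dA t).
have uA : ons_matrix eps f w t.+1 \in unitmx by rewrite unitmxE unitfE gt_eqF.
(* The product of [g] with [w t.+1 - u], which is [- z], is split at [w t.+2]: this inequality
   covers the first piece, its quadratic term being paid by [- eta * bregman A' (w t.+2) (w t.+1)]
   from the three-point inequality, which covers the second. *)
have := linear_sub_quad_le g (w t.+1 - w t.+2) (sA t.+1) (psd t.+1) uA eta0.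
have := argmin_three_point (sA t.+1) cB cr wmin Bu; rewrite -/g.
have : bregman (ons_matrix eps f w t.+1) u (w t.+1)
    = bregman (ons_matrix eps f w t) u (w t.+1) + 2^-1 * z ^+ 2.
  rewrite !bregmanE /= mulmxDl dotvDr dotv_rank1 -/g -zE; ring.
rewrite [ons_matrix eps f w t + _](_ : _ = ons_matrix eps f w t.+1)//.
move: (ons_matrix eps f w t) (ons_matrix eps f w t.+1) => A A' -> three lin logd.
have sym : bregman A' (w t.+2) (w t.+1)
    = 2^-1 * dotv (w t.+1 - w t.+2) (A' *m (w t.+1 - w t.+2)).
  rewrite bregmanE -[w t.+2 - _]opprB mulmxN dotvNr dotvNl; ring.
have inv0 : 0 < (2 * eta)^-1 by rewrite invr_gt0 mulr_gt0.
have logd' := ler_wpM2l (ltW inv0) logd.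
move: three lin; rewrite sym zE !dotvBr.
lra.
Qed.

(** Every round counted here has a constrained update, so in the final bound this serves for all
    rounds but the last. *)
Lemma ons_sum (R : realType) (n : nat) (eps eta : R) (B : set 'cV[R]_n)
    (r : 'cV[R]_n -> R) (f : nat -> 'cV[R]_n -> R) (w : nat -> 'cV[R]_n)
    (u : 'cV[R]_n) (T : nat) :
  0 < eps -> 0 < eta -> convex_set B -> convex_function setT r -> B u ->
  (forall t, (1 <= t < T.+1)%N ->
    argmin B (ons_objective eps eta r f w t) (w t.+1)) ->
  (forall t, (1 <= t < T.+1)%N ->
    dotv (grad (f t) (w t)) (u - w t)
      + eta / 2 * dotv (grad (f t) (w t)) (u - w t) ^+ 2
      <= f t u - f t (w t)) ->
  \sum_(1 <= t < T.+1) (f t (w t) + r (w t) - f t u - r u)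
    <= ons_potential eps eta r f w u 0 - ons_potential eps eta r f w u T.
Proof.
move=> eps0 eta0 cB cr Bu; elim: T => [|T IH] wmin lb.
  by rewrite big_geq// subrr.
rewrite big_nat_recr//=.
have h t : (1 <= t < T.+1)%N -> (1 <= t < T.+2)%N.
  by case/andP=> -> /leqW.
have {}IH := IH (fun t ht => wmin t (h t ht)) (fun t ht => lb t (h t ht)).
have := ons_round eps0 eta0 cB cr Bu erefl (wmin T.+1 (leqnn _)).
have := lb T.+1 (leqnn _).
lra.
Qed.

(** * The logarithmic regret bound *)

Theorem theorem1 (R : realType) (n : nat) (hn : (1 <= n)%N) (alpha G D : R)
    (halpha : 0 < alpha) (hG : 0 < G) (hD : 0 < D)
    (B : set 'cV[R]_n) (hB0 : B !=set0) (hBclosed : closed B)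
    (hBconvex : convex_set B) (hBdiam : l2diameter B = D%:E)
    (r : 'cV[R]_n -> R) (hr : convex_function setT r) :
  let eta := 2^-1 * Num.min alpha (1 / (4 * G * D)) in
  let eps := 1 / (eta ^+ 2 * D ^+ 2) in
  exists C : R,
    forall (T : nat), (2 <= T)%N ->
    forall (f : nat -> 'cV[R]_n -> R),
      (forall t, (1 <= t <= T)%N ->
        [/\ convex_function B (f t),
            forall x, B x -> differentiable (f t) x,
            exp_concave alpha B (f t) &
            forall x, B x -> l2norm (grad (f t) x) <= G]) ->
    forall (w : nat -> 'cV[R]_n), composite_ons eps eta B r T f w ->
    forall wstar : 'cV[R]_n, B wstar ->
      \sum_(1 <= t < T.+1) (f t (w t) + r (w t) - f t wstar - r wstar)
        <= C * ln T%:R.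
Proof.
move=> eta eps.
have [b0 Bb0] := hB0.
have GD0 : 0 < G * D by exact: mulr_gt0.
have c0 : 0 < 1 / (4 * G * D) by rewrite divr_gt0// -mulrA mulr_gt0.
have gamma0 : 0 < Num.min alpha (1 / (4 * G * D)) by rewrite lt_min halpha.
have eta2 : 2 * eta = Num.min alpha (1 / (4 * G * D)) by rewrite /eta mulVKf.
have eta0 : 0 < eta by rewrite /eta mulr_gt0// invr_gt0.
have eps0 : 0 < eps by rewrite divr_gt0// mulr_gt0// exprn_gt0.
have diam := l2norm_diameter hBdiam.
(* The box of this half-width around the origin contains [B], since every point of [B] is within [D]
   of [b0]. *)
have M0 : 0 <= D + l2norm b0 by rewrite addr_ge0 ?sqrtr_ge0// ltW.
have [K HK] := convex_bounded hr M0.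
have rK x : B x -> `|r x| <= K.
  move=> Bx; apply: HK => i.
  rewrite -[x](subrK b0) mxE; apply: le_trans (ler_normD _ _) _.
  apply: lerD; last exact: abs_coord_le_l2norm.
  exact: le_trans (abs_coord_le_l2norm _ _) (diam _ _ Bx Bb0).
have inner_le g u v : l2norm g <= G -> B u -> B v -> `|dotv g (u - v)| <= G * D.
  move=> gG Bu Bv; apply: le_trans (cauchy_schwarz_dotv _ _) _.
  by apply: ler_pM (diam _ _ Bu Bv) => //; exact: sqrtr_ge0.
(* In order: the initial divergence, the surviving [r (w 1) - r u], the linear loss of the last
   round, and the part of the log-determinant growth free of [T]. *)
pose c := 2^-1 * (eta * eps * D ^+ 2) + 2 * K + G * D
  + (2 * eta)^-1 * (ln n`!%:R + n%:R * ln (eps + G ^+ 2) - ln (eps ^+ n)).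
(* Since [T >= 2], dividing by [ln 2] turns the constant [c] into a multiple of [ln T]; the second
   summand is the coefficient of [ln T] in the log-determinant bound. *)
exists (`|c| / ln 2 + (2 * eta)^-1 * n%:R) => T T2 f hf w [Bw1 wmin] u Bu.
have lnT : ln 2 <= ln T%:R :> R by rewrite ler_ln ?posrE ?ltr0n ?ler_nat// (leq_trans _ T2).
have ln2 : 0 < ln 2 :> R by rewrite ln_gt0// ltr1n.
have Bw t : (1 <= t <= T)%N -> B (w t).
  case: t => [//|[//|t]] /andP[_ tT].
  by have [] := wmin t.+1 tT.
case: T T2 hf wmin lnT Bw => [//|S] S1 hf wmin lnT Bw.
have gG t : (1 <= t <= S.+1)%N -> l2norm (grad (f t) (w t)) <= G.
  by move=> ht; have [_ _ _] := hf t ht; apply; exact: Bw.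
have lb t : (1 <= t < S.+1)%N ->
    dotv (grad (f t) (w t)) (u - w t)
      + eta / 2 * dotv (grad (f t) (w t)) (u - w t) ^+ 2 <= f t u - f t (w t).
  move=> /andP[t1 tS]; have ht : (1 <= t <= S.+1)%N by rewrite t1 ltnW.
  have [_ df ef _] := hf t ht; have Bt := Bw t ht.
  (* The quadratic bound is applied with [gamma = 2 * eta], the minimum in the definition of [eta]:
     its first entry gives [gamma <= alpha], its second the smallness condition [1 / 4]. *)
  rewrite (_ : eta / 2 = 2 * eta / 4); last by field.
  rewrite eta2; apply: (exp_concave_quadratic gamma0 _ ef Bt Bu (df _ Bt)).
    by rewrite ge_min lexx.
  apply: (@le_trans _ _ (1 / (4 * G * D) * (G * D))).
    by apply: ler_pM; rewrite ?(ltW gamma0)// ?ge_min ?lexx ?orbT// inner_le ?gG.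
  by rewrite le_eqVlt; apply/orP; left; apply/eqP; field; rewrite !gt_eqF.
have sumS := ons_sum eps0 eta0 hBconvex hr Bu wmin lb.
have last_round : f S.+1 (w S.+1) - f S.+1 u <= G * D.
  have hS : (1 <= S.+1 <= S.+1)%N by rewrite leqnn.
  have [cf df _ _] := hf _ hS; have BS := Bw _ hS.
  have := convex_grad_le cf BS Bu (df _ BS).
  have := inner_le _ _ _ (gG _ hS) Bu BS; rewrite ler_norml => /andP[]; lra.
have pot0 : bregman (ons_matrix eps f w 0) u (w 1%N) <= 2^-1 * (eps * D ^+ 2).
  rewrite bregmanE /= mul_scalar_mx dotvZr ler_wpM2l ?invr_ge0// ler_wpM2l ?(ltW eps0)//.
  rewrite -[dotv _ _]sqr_sqrtr ?dotv_ge0// lerXn2r ?nnegrE ?sqrtr_ge0 ?(ltW hD)//.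
  exact: diam.
have potS : 0 <= bregman (ons_matrix eps f w S) u (w S.+1).
  by rewrite bregmanE mulr_ge0 ?invr_ge0// ons_matrix_psd// ltW.
have detS : ln (\det (ons_matrix eps f w S))
    <= ln n`!%:R + n%:R * ln (eps + G ^+ 2) + n%:R * ln S.+1%:R.
  have E0 : 0 < eps + G ^+ 2 by rewrite addr_gt0// exprn_gt0.
  have F0 : 0 < n`!%:R :> R by rewrite ltr0n fact_gt0.
  have S0 : 0 < S.+1%:R :> R by rewrite ltr0n.
  rewrite -addrA -mulrDr -lnM ?posrE// mulr_natl -lnXn ?mulr_gt0//.
  rewrite -lnM ?posrE ?exprn_gt0 ?mulr_gt0// ler_ln ?posrE ?ons_matrix_det_gt0//; last first.
    by rewrite mulr_gt0 ?exprn_gt0 ?mulr_gt0.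
  apply: det_le_bound => i j.
  have gGS s : (1 <= s <= S)%N -> l2norm (grad (f s) (w s)) <= G.
    by case/andP=> s1 sS; apply: gG; rewrite s1 leqW.
  (* What remains is [eps + S * G ^+ 2 <= (eps + G ^+ 2) * S.+1], a product form that lets the
     logarithm split off [ln S.+1]. *)
  apply: le_trans (ons_matrix_entry_le (ltW eps0) (ltW hG) gGS i j) _.
  have SG : 0 <= S%:R * eps by rewrite mulr_ge0// ltW.
  have G2 : 0 <= G ^+ 2 by exact: sqr_ge0.
  rewrite -natr1; lra.
have inv0 : 0 < (2 * eta)^-1 by rewrite invr_gt0 mulr_gt0.
have detS' := ler_wpM2l (ltW inv0) detS.
have pot0' := ler_wpM2l (ltW eta0) pot0.
have potS' := mulr_ge0 (ltW eta0) potS.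
have rw1 := ler_norm (r (w 1%N)).
have ru := ler_norm (- r u); rewrite normrN in ru.
have rKw := rK _ Bw1; have rKu := rK _ Bu.
have cle : c <= `|c| / ln 2 * ln S.+1%:R.
  apply: le_trans (ler_norm c) _; rewrite mulrAC ler_pdivlMr//.
  by rewrite ler_wpM2l.
rewrite big_nat_recr//=.
have det0 : \det (ons_matrix eps f w 0) = eps ^+ n by exact: det_scalar.
move: sumS; rewrite /ons_potential det0 => sumS.
rewrite mulrDl; apply: le_trans (lerD cle (lexx _)).
rewrite /c; lra.
Qed.
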